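(* For every positive integer $n$, $$ C_n=\frac14\csc^2\bigg(\frac{\pi}{4n+2}\bigg)=\frac{4n^2}{\pi^2}+\frac{4n}{\pi^2}+\bigg(\frac{1}{12}+\frac{1}{\pi^2}\bigg)+\mathcal{O}\bigg(\frac{1}{n^2}\bigg), $$ where the $\mathcal{O}$-term refers to $n\to\infty$.
   Context: For a positive integer $n$, let $K_n$ denote the (finite) set of all nonsingular $n\times n$ lower triangular $(0,1)$-matrices, i.e., lower triangular matrices with all entries in $\{0,1\}$ that are invertible as real matrices (equivalently, all diagonal entries equal $1$). Define $$ C_n=\max\{\lambda\mid \lambda\text{ is an eigenvalue of }XX^{\mathrm T},\ X\in K_n\}. $$ *)

(* Defs.v *)
From mathcomp Require Import all_boot all_order all_algebra.
From mathcomp Require Import all_classical all_reals all_analysis.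

Set Implicit Arguments.
Unset Strict Implicit.
Unset Printing Implicit Defensive.

Import Order.TTheory GRing.Theory Num.Theory.
Import numFieldNormedType.Exports.

Local Open Scope classical_set_scope.
Local Open Scope ring_scope.

(* [is_trig_mx X] says [X i j = 0] for [i < j], i.e. lower triangular. *)
Definition K (R : realType) (n : nat) : set 'M[R]_n :=
  [set X | [/\ is_trig_mx X, (forall i j, X i j = 0 \/ X i j = 1)
             & X \in unitmx]].

Definition gram_eigenvalues (R : realType) (n : nat) : set R :=
  [set l | exists2 X : 'M[R]_n, K X & eigenvalue (X *m X^T) l].

(* [A `&` ubound A] contains at most the greatest element of [A]; the default
   value 0 is returned only when [A] has no greatest element or when that
   element is itself 0, so [maximum A = x] with [x != 0] entails that the
   maximum exists (see [maximumP]). *)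
Definition maximum (R : realType) (A : set R) : R := xget 0 (A `&` ubound A).

Lemma maximumP (R : realType) (A : set R) :
  maximum A != 0 -> A (maximum A) /\ ubound A (maximum A).
Proof. by rewrite /maximum; case: xgetP => [x _ []|]; rewrite ?eqxx. Qed.

Lemma maximum_eq (R : realType) (A : set R) (x : R) :
  A x -> ubound A x -> maximum A = x.
Proof.
move=> Ax ubx; apply: xget_unique => // y [Ay uby].
by apply/eqP; rewrite eq_le ubx//= uby.
Qed.

Definition C (R : realType) (n : nat) : R := maximum (@gram_eigenvalues R n).

Definition csc (R : realType) (x : R) : R := (sin x)^-1.

(* Main.v *)
Require Import Defs.
From mathcomp Require Import all_boot all_order all_algebra.
From mathcomp Require Import all_classical all_reals all_analysis.
From mathcomp Require Import ring lra.

Set Implicit Arguments.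
Unset Strict Implicit.
Unset Printing Implicit Defensive.

Import Order.TTheory GRing.Theory Num.Theory.
Import numFieldNormedType.Exports.

Local Open Scope classical_set_scope.
Local Open Scope ring_scope.

(** Among the matrices [X] in [K R n], the lower triangular matrix [T] with all
    entries [1] on and below the diagonal dominates every other one entrywise,
    hence [X X^T] is dominated entrywise by [T T^T], whose entries are
    [min(i, j)] (counting from 1).  All these matrices are nonnegative, and the
    spectral radius is monotone on nonnegative matrices, so the maximum [C R n]
    is the Perron root of [T T^T].

    The Perron root is found by exhibiting a positive eigenvector.  With
    [x = pi / (4 n + 2)], put [w_i = sin (2 i x)] for [1 <= i <= n]; all these
    angles lie strictly between [0] and [pi].  Both factors of [T T^T] act on
    [w] by telescoping sums: [T^T] forms tail sums and turns [w] into
    [cos ((2 k - 1) x) / (2 sin x)], the boundary term vanishing because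
    [cos ((2 n + 1) x) = cos (pi / 2) = 0]; then [T] forms initial sums and
    gives back [w] divided by [4 sin^2 x] (lemma [sine_vector_eigen]).

    A positive eigenvector is also all that the upper bound requires
    (lemma [eigenvalue_norm_le]): if [v A = l v] with [0 <= A <= B] entrywise
    and [B w = r w] with [w > 0], pairing [|l| |v| <= |v| B] with [w] gives
    [|l| (|v| w) <= r (|v| w)], and [|v| w > 0].

    The asymptotic formula is the Laurent expansion
    [csc^2 x = x^-2 + 1/3 + O(x^2)] at [x = pi / (4 n + 2)], where
    [x^-2 / 4 = (2 n + 1)^2 / pi^2] is the explicit quadratic polynomial in
    [n].  The expansion rests on the Taylor bounds of [sin] of orders 3 and 5,
    each obtained from the previous order by integrating once. *)

(** * Eigenvalues of entrywise dominated matrices *)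

(** Comparison with a positive eigenvector replaces both the Perron-Frobenius
    theorem and the variational description of eigenvalues. *)
Lemma eigenvalue_norm_le (F : realFieldType) (n : nat) (A B : 'M[F]_n)
    (w : 'cV[F]_n) (l r : F) :
  (forall i j, 0 <= A i j <= B i j) -> (forall i, 0 < w i 0) ->
  B *m w = r *: w -> eigenvalue A l -> `|l| <= r.
Proof.
move=> AB w0 Bw /eigenvalueP[v vA v0].
have S0 : 0 < \sum_j `|v 0 j| * w j 0.
  have /rV0Pn[i vi0] := v0.
  rewrite (bigD1 i)//= ltr_pwDl ?mulr_gt0 ?normr_gt0//.
  by apply: sumr_ge0 => j _; rewrite mulr_ge0// ltW.
rewrite -(ler_pM2r S0).
have step j : `|l| * `|v 0 j| <= \sum_i `|v 0 i| * B i j.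
  have -> : `|l| * `|v 0 j| = `|\sum_i v 0 i * A i j|.
    by rewrite -normrM; have /rowP/(_ j) := vA; rewrite !mxE => ->.
  apply: le_trans (ler_norm_sum _ _ _) _; apply: ler_sum => i _.
  have /andP[A0 AleB] := AB i j.
  by rewrite normrM (ger0_norm A0) ler_wpM2l.
apply: (@le_trans _ _ (\sum_j (\sum_i `|v 0 i| * B i j) * w j 0)).
  rewrite mulr_sumr; apply: ler_sum => j _.
  by rewrite mulrA ler_wpM2r// ltW.
under eq_bigr do rewrite mulr_suml.
rewrite exchange_big/= mulr_sumr le_eqVlt; apply/orP; left.
apply/eqP/eq_bigr => i _.
have /colP/(_ i) := Bw; rewrite !mxE => BwE.
by rewrite mulrCA -BwE mulr_sumr; apply: eq_bigr => j _; rewrite mulrA.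
Qed.

(** * The extremal matrix *)

Definition ones_trig (F : nzRingType) (n : nat) : 'M[F]_n :=
  \matrix_(i, j) (j <= i)%N%:R.

Lemma ones_trig_K (R : realType) (n : nat) : K (ones_trig R n).
Proof.
have trig : is_trig_mx (ones_trig R n).
  by apply/is_trig_mxP => i j ij; rewrite mxE leqNgt ij.
split=> //.
  by move=> i j; rewrite mxE; case: (_ <= _)%N; [right|left].
rewrite unitmxE det_trig// big1 ?unitr1// => i _.
by rewrite mxE leqnn.
Qed.

(** Entries of [X] above the diagonal vanish and the others are at most 1, so
    [0 <= X <= ones_trig R n], which nonnegative products preserve. *)
Lemma K_gram_le (R : realType) (n : nat) (X : 'M[R]_n) : K X ->
  forall i j, 0 <= (X *m X^T) i j <= (ones_trig R n *m (ones_trig R n)^T) i j.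
Proof.
move=> [/is_trig_mxP trig X01 _] i j.
have X0 a b : 0 <= X a b by case: (X01 a b) => ->.
have XT a b : X a b <= ones_trig R n a b.
  rewrite mxE; case: leqP => [_|/trig -> //].
  by case: (X01 a b) => ->.
rewrite !mxE; apply/andP; split.
  by apply: sumr_ge0 => k _; rewrite mxE mulr_ge0.
by apply: ler_sum => k _; rewrite [X^T _ _]mxE [_^T _ _]mxE ler_pM.
Qed.

(** * The Perron eigenvector *)

(** With indices counted from 1 the entries are [sin (2 i x)]: the index [i]
    of a column starts at 0, whence the successor. *)
Definition sine_vector (R : realType) (n : nat) (x : R) : 'cV[R]_n :=
  \col_i sin (2 * i.+1%:R * x).

(** The sum telescopes because
    [2 sin x * sin (2 j x) = cos ((2 j - 1) x) - cos ((2 j + 1) x)]; the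
    hypothesis on [n] kills the upper boundary term. *)
Lemma sum_sin_tail (R : realType) (n k : nat) (x : R) :
  (k <= n)%N -> sin x != 0 ->
  cos ((2 * n%:R + 1) * x) = 0 ->
  \sum_(k <= j < n) sin (2 * j.+1%:R * x)
    = cos ((2 * k%:R + 1) * x) / (2 * sin x).
Proof.
move=> kn sx0 cn0; pose u j : R := - (cos ((2 * j%:R + 1) * x) / (2 * sin x)).
rewrite (eq_bigr (fun j => u j.+1 - u j)).
  by rewrite telescope_sumr// /u cn0; ring.
move=> j _; rewrite /u.
have -> : (2 * j.+1%:R + 1) * x = 2 * j.+1%:R * x + x by ring.
have -> : (2 * j%:R + 1) * x = 2 * j.+1%:R * x - x by rewrite -natr1; ring.
by rewrite cosD cosB; field.
Qed.

(** The sum telescopes because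
    [2 sin x * cos ((2 j + 1) x) = sin ((2 j + 2) x) - sin (2 j x)]. *)
Lemma sum_cos_odd (R : realType) (k : nat) (x : R) : sin x != 0 ->
  \sum_(0 <= j < k) cos ((2 * j%:R + 1) * x) = sin (2 * k%:R * x) / (2 * sin x).
Proof.
move=> sx0; pose u j : R := sin (2 * j%:R * x) / (2 * sin x).
rewrite (eq_bigr (fun j => u j.+1 - u j)).
  by rewrite telescope_sumr// /u mulr0 mul0r sin0 mul0r subr0.
move=> j _; rewrite /u.
have -> : 2 * j.+1%:R * x = (2 * j%:R + 1) * x + x by rewrite -natr1; ring.
have -> : 2 * j%:R * x = (2 * j%:R + 1) * x - x by ring.
by rewrite sinD sinB; field.
Qed.

(** Multiplication by the transpose of [ones_trig R n] forms tail sums, and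
    multiplication by [ones_trig R n] forms initial sums, so that
    [sum_sin_tail] and [sum_cos_odd] apply one after the other. *)
Lemma sine_vector_eigen (R : realType) (n : nat) (x : R) : sin x != 0 ->
  cos ((2 * n%:R + 1) * x) = 0 ->
  (ones_trig R n *m (ones_trig R n)^T) *m sine_vector n x
    = (1 / 4 * csc x ^+ 2) *: sine_vector n x.
Proof.
move=> sx0 cn0; rewrite -mulmxA.
have -> : (ones_trig R n)^T *m sine_vector n x
    = \col_k (cos ((2 * k%:R + 1) * x) / (2 * sin x)).
  apply/colP => k; rewrite !mxE -(@sum_sin_tail R n) ?(ltnW (ltn_ord k))//.
  rewrite big_geq_mkord [RHS]big_mkcond/=.
  by apply: eq_bigr => j _; rewrite !mxE; case: leqP; rewrite ?mul1r ?mul0r.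
apply/colP => i; rewrite !mxE.
transitivity (\sum_(0 <= k < i.+1) cos ((2 * k%:R + 1) * x) / (2 * sin x)).
  rewrite big_mkord
    (big_ord_widen n (fun k => cos ((2 * k%:R + 1) * x) / (2 * sin x)))//=
    [RHS]big_mkcond/=.
  by apply: eq_bigr => k _; rewrite !mxE ltnS; case: leqP; rewrite ?mul1r ?mul0r.
by rewrite -mulr_suml sum_cos_odd// /csc; field.
Qed.

(** The angles [2 i x], for [i] from 1 to [n], lie in the open interval from [0]
    to [pi], so the eigenvector [sine_vector n x] is positive and bounds the
    eigenvalues of all the Gram matrices; its own eigenvalue is attained at
    [ones_trig R n]. *)
Lemma C_eq (R : realType) (n : nat) : (0 < n)%N ->
  C R n = 1 / 4 * csc (pi / (4 * n%:R + 2)) ^+ 2.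
Proof.
move=> n0; set x : R := pi / _.
have xE : x * (4 * n%:R + 2) = pi by rewrite /x mulfVK// lt0r_neq0// ltr_wpDl.
have n1 : 1 <= n%:R :> R by rewrite ler1n.
have x0 : 0 < x by rewrite divr_gt0 ?pi_gt0// ltr_wpDl.
have xpos i : (i < n)%N -> 0 < sin (2 * i.+1%:R * x).
  move=> lin; have : i.+1%:R <= n%:R :> R by rewrite ler_nat.
  move=> lin'; apply: sin_gt0_pi; rewrite mulr_gt0//= ?mulr_gt0//.
  by rewrite -xE; nra.
have sx0 : sin x != 0.
  by apply/lt0r_neq0/sin_gt0_pi; rewrite x0 -xE; nra.
have cn0 : cos ((2 * n%:R + 1) * x) = 0.
  have -> : (2 * n%:R + 1) * x = pi / 2 by rewrite -xE; field.
  exact: cos_pihalf.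
have eig := sine_vector_eigen sx0 cn0.
have wpos i : 0 < sine_vector n x i 0 by rewrite mxE xpos.
apply: maximum_eq.
  exists (ones_trig R n); first exact: ones_trig_K.
  apply/eigenvalueP; exists (sine_vector n x)^T.
    by have := congr1 trmx eig; rewrite trmx_mul trmx_mul trmxK linearZ.
  apply/rV0Pn; exists (Ordinal n0); rewrite mxE gt_eqF// xpos.
move=> l [X KX lX]; apply: le_trans (ler_norm l) _.
exact: eigenvalue_norm_le (K_gram_le KX) wpos eig lX.
Qed.

(** * Taylor bounds for sine and the expansion of the squared cosecant *)

(** This is the step from each Taylor bound to the next: the derivative of the
    difference between [sin] or [cos] and its Taylor polynomial is, up to sign,
    the difference treated at the previous order. *)
Lemma ge_initial_of_derive_ge0 (R : realType) (f f' : R -> R) :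
  (forall x : R, is_derive x 1 f (f' x)) -> (forall x, 0 <= x -> 0 <= f' x) ->
  forall x, 0 <= x -> f 0 <= f x.
Proof.
move=> df f'0 x x0.
apply: (@ger0_derive1_le_cc R f 0 x) => //; rewrite ?in_itv/= ?lexx ?x0//.
- move=> y; rewrite in_itv/= => /andP[y0 _].
  by rewrite derive1E derive_val f'0// ltW.
- apply: continuous_subspaceT => y; apply: differentiable_continuous.
  by apply/derivable1_diffP.
Qed.

Lemma sin_le_id (R : realType) (x : R) : 0 <= x -> sin x <= x.
Proof.
move=> x0; rewrite -subr_ge0.
have := @ge_initial_of_derive_ge0 R (fun y => y - sin y) (fun y => 1 - cos y).
rewrite sin0 subr0; exact.
Qed.

Lemma cos_ge_taylor2 (R : realType) (x : R) : 0 <= x -> 1 - x ^+ 2 / 2 <= cos x.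
Proof.
move=> x0; rewrite -subr_ge0.
have := @ge_initial_of_derive_ge0 R (fun y => cos y - (1 - y ^+ 2 / 2))
  (fun y => y - sin y).
rewrite cos0 expr0n/= mul0r subr0 subrr; apply=> // y.
  by apply: is_derive_eq; rewrite /GRing.scale/=; field.
by move=> y0; rewrite subr_ge0 sin_le_id.
Qed.

Lemma sin_ge_taylor3 (R : realType) (x : R) : 0 <= x -> x - x ^+ 3 / 6 <= sin x.
Proof.
move=> x0; rewrite -subr_ge0.
have := @ge_initial_of_derive_ge0 R (fun y => sin y - (y - y ^+ 3 / 6))
  (fun y => cos y - (1 - y ^+ 2 / 2)).
rewrite sin0 expr0n/= mul0r !subr0; apply=> // y.
  by apply: is_derive_eq; rewrite /GRing.scale/=; field.
by move=> y0; rewrite subr_ge0 cos_ge_taylor2.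
Qed.

Lemma cos_le_taylor4 (R : realType) (x : R) :
  0 <= x -> cos x <= 1 - x ^+ 2 / 2 + x ^+ 4 / 24.
Proof.
move=> x0; rewrite -subr_ge0.
have := @ge_initial_of_derive_ge0 R
  (fun y => 1 - y ^+ 2 / 2 + y ^+ 4 / 24 - cos y)
  (fun y => sin y - (y - y ^+ 3 / 6)).
rewrite cos0 !expr0n/= !mul0r subr0 addr0 subrr; apply=> // y.
  by apply: is_derive_eq; rewrite /GRing.scale/=; field.
by move=> y0; rewrite subr_ge0 sin_ge_taylor3.
Qed.

Lemma sin_le_taylor5 (R : realType) (x : R) :
  0 <= x -> sin x <= x - x ^+ 3 / 6 + x ^+ 5 / 120.
Proof.
move=> x0; rewrite -subr_ge0.
have := @ge_initial_of_derive_ge0 R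
  (fun y => y - y ^+ 3 / 6 + y ^+ 5 / 120 - sin y)
  (fun y => 1 - y ^+ 2 / 2 + y ^+ 4 / 24 - cos y).
rewrite sin0 !expr0n/= !mul0r !subr0 addr0; apply=> // y.
  by apply: is_derive_eq; rewrite /GRing.scale/=; field.
by move=> y0; rewrite subr_ge0 cos_le_taylor4.
Qed.

(** Write [y = x^2] and [sin x = x q].  The difference is
    [(1 - (1 + y / 3) q^2) / (y q^2)]; since [q = 1 - y / 6 + O(y^2)], the terms
    of order [y] in the numerator cancel, so the numerator is [O(y^2)], while
    the denominator is at least [y / 2]. *)
Lemma csc_sqr_expansion (R : realType) (x : R) : 0 < x <= 1 ->
  `|csc x ^+ 2 - (x ^- 2 + 1 / 3)| <= 2 * x ^+ 2.
Proof.
move=> /andP[x0 x1]; have x0' := ltW x0; have xn0 := lt0r_neq0 x0.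
pose y := x ^+ 2; pose q := sin x / x.
have y0 : 0 < y by rewrite exprn_gt0.
have y1 : y <= 1 by rewrite expr_le1.
have sE : sin x = x * q by rewrite /q; field.
have qlo : 1 - y / 6 <= q.
  rewrite -(ler_pM2l x0) -sE; apply: le_trans _ (sin_ge_taylor3 x0').
  by rewrite /y le_eqVlt; apply/orP; left; apply/eqP; field.
have qhi : q <= 1 - y / 6 + y ^+ 2 / 120.
  rewrite -(ler_pM2l x0) -sE; apply: le_trans (sin_le_taylor5 x0') _.
  by rewrite /y le_eqVlt; apply/orP; left; apply/eqP; field.
have q0 : 0 < q by nra.
have -> : csc x ^+ 2 - (x ^- 2 + 1 / 3)
    = (1 - (1 + y / 3) * q ^+ 2) / (y * q ^+ 2).
  by rewrite /csc sE /y; field; rewrite xn0 lt0r_neq0.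
have yq0 : 0 < y * q ^+ 2 by rewrite mulr_gt0 ?exprn_gt0.
rewrite normrM normfV (gtr0_norm yq0) ler_pdivrMr//.
have q2lo : (1 - y / 6) ^+ 2 <= q ^+ 2 by rewrite ler_pXn2r// nnegrE; nra.
have q2hi : q ^+ 2 <= (1 - y / 6 + y ^+ 2 / 120) ^+ 2.
  by rewrite ler_pXn2r// nnegrE; nra.
have qhalf : 1 / 2 <= q ^+ 2 by apply: le_trans q2lo; nra.
apply: (@le_trans _ _ (y ^+ 2)).
  rewrite ler_norml; apply/andP; split.
    apply: (@le_trans _ _
      (1 - (1 + y / 3) * (1 - y / 6 + y ^+ 2 / 120) ^+ 2)).
      have y2 : y ^+ 2 <= 1 by rewrite expr_le1// ltW.
      nra.
    by rewrite lerB// ler_pM2l//; lra.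
  apply: (@le_trans _ _ (1 - (1 + y / 3) * (1 - y / 6) ^+ 2)); last nra.
  by rewrite lerB// ler_pM2l//; lra.
rewrite -/y (_ : 2 * y * _ = y ^+ 2 * (2 * q ^+ 2)); last by ring.
by rewrite ler_peMr ?exprn_ge0 ?(ltW y0)//; lra.
Qed.

(** * The closed form and its asymptotic expansion *)

Theorem theorem3p1 (R : realType) :
  (forall n : nat, (0 < n)%N ->
     C R n = 1 / 4 * csc (pi / (4 * n%:R + 2)) ^+ 2) /\
  (fun n : nat => C R n) =
    (fun n : nat => 4 * n%:R ^+ 2 / pi ^+ 2 + 4 * n%:R / pi ^+ 2
                    + (1 / 12 + 1 / pi ^+ 2))
    +O_\oo (fun n : nat => 1 / n%:R ^+ 2 : R).
Proof.
split; first exact: C_eq.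
apply/eqaddOP; near=> k; near=> n.
have n0 : (0 < n)%N by near: n; exact: nbhs_infty_gt.
have n1 : 1 <= n%:R :> R by rewrite ler1n.
have pi0 : 0 < pi :> R := pi_gt0 R.
(* With [pi <= 4], [x <= pi / (4 n) <= 1 / n]; and [n >= 1] gives [x <= 1]. *)
have pi4 : pi <= 4 :> R by have := @pihalf_lt2 R; lra.
rewrite !fctE/= C_eq//; set x : R := pi / (4 * n%:R + 2).
have d0 : 0 < 4 * n%:R + 2 :> R by lra.
have xE : x * (4 * n%:R + 2) = pi by rewrite /x mulfVK// lt0r_neq0.
have x0 : 0 < x by rewrite divr_gt0.
have x1 : x <= 1 by rewrite ler_pdivrMr//; lra.
have xn : x <= n%:R^-1.
  rewrite ler_pdivrMr// [_^-1 * _]mulrC ler_pdivlMr ?(lt_le_trans ltr01)//.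
  by nra.
have -> : (1 / 4 * csc x ^+ 2 - (4 * n%:R ^+ 2 / pi ^+ 2 + 4 * n%:R / pi ^+ 2
                    + (1 / 12 + 1 / pi ^+ 2)))
   = 1 / 4 * (csc x ^+ 2 - (x ^- 2 + 1 / 3)).
  (* Substituting [pi = x (4 n + 2)] leaves a rational identity in [x], [n]. *)
  rewrite -xE; field.
  by rewrite !lt0r_neq0.
have k1 : 1 <= k by near: k; exact: nbhs_pinfty_ge.
have e0 : 0 <= 1 / n%:R ^+ 2 :> R by rewrite divr_ge0// exprn_ge0.
rewrite (ger0_norm e0).
apply: (@le_trans _ _ (1 / n%:R ^+ 2)); last by rewrite ler_peMl.
rewrite normrM ger0_norm//.
have := @csc_sqr_expansion R x; rewrite x0 x1 => /(_ isT) cscx.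
have : x ^+ 2 <= 1 / n%:R ^+ 2.
  by rewrite div1r -exprVn lerXn2r// nnegrE ?invr_ge0// ltW.
by nra.
Unshelve. all: by end_near.
Qed.
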